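(* Let $\ell(\alpha,0)$ be a line of $\mathbb A$ ($\alpha\in\mathrm{Hom}(U,W)$, $\alpha\neq 0$), and let $U'\le U$ be a central complement of $\ker(\alpha)$ in $U$. Then $$\ell(\alpha,0)\cap(W\oplus U')=\ell(\alpha,0)\cap(\mathrm{im}(\alpha)\oplus U'),$$ and this set is an affine regulus (with respect to $\mathrm{im}(\alpha)$) in $\mathbb P(K,\mathrm{im}(\alpha)\oplus U')\cong\mathbb P(K,U'\times U')$. The associated regulus $\mathcal R$ is the unique one containing $\mathrm{im}(\alpha)$, $U'$, and $U'^{(\alpha,1)}:=\{u^\alpha+u\mid u\in U'\}$ that has a transversal set $\mathcal T$ satisfying $$\{\mathrm{im}(\alpha)+T\mid T\in\mathcal T\}=\{\mathrm{im}(\alpha)+P\mid P\in\mathcal Z(U')\}.$$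
   Context: $K$ is a not necessarily commutative field (division ring) with center $Z$, $V$ is a left vector space over $K$ of arbitrary dimension, $W\le V$ is a subspace with $W\ne\{0\}$, $W\neq V$, $U\le V$ is a fixed complement of $W$ ($V=W\oplus U$), and $(b_i)_{i\in I}$ is a fixed basis of $U$. Linear maps are written as exponents on the right and composed from left to right. $\mathcal S:=\{S\le V\mid V=W\oplus S\}$; for $\gamma\in\mathrm{Hom}(U,W)$ put $U^{(\gamma,1)}:=\{u^\gamma+u\mid u\in U\}$; the map $\gamma\mapsto U^{(\gamma,1)}$ is a bijection $\mathrm{Hom}(U,W)\to\mathcal S$. For $k\in K$ let $\lambda_k\in\mathrm{End}(U)$ be the $K$-linear map with $b_i\mapsto kb_i$. $\mathbb A$ is the affine space with point set $\mathcal S$ associated with the left $K$-vector space structure $U^{(\gamma,1)}+U^{(\eta,1)}=U^{(\gamma+\eta,1)}$, $k\cdot U^{(\gamma,1)}=U^{(\lambda_k\gamma,1)}$; its lines are the sets $\ell(\alpha,\beta):=\{U^{(\lambda_k\alpha+\beta,1)}\mid k\in K\}$ ($\alpha,\beta\in\mathrm{Hom}(U,W)$, $\alpha\ne0$). For a subspace $Y\le V$ write $\ell(\alpha,0)\cap Y:=\{X\cap Y\mid X\in\ell(\alpha,0)\}$. A subspace of $U$ is called central if it possesses a basis consisting of $Z$-linear combinations of the $b_i$. For a central subspace $U'$, $\mathcal Z(U')$ is the projective $Z$-subspace with respect to such a (central) basis of $U'$, i.e. the set of points $Kz$ with $z\neq0$ a $Z$-linear combination of the vectors of that basis. $\mathbb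 P(K,Y)$ is the projective space of subspaces of $Y$ (points and lines are the subspaces of dimension one and two). A regulus in $\mathbb P(K,Y)$ is a set of subspaces of $Y$ which, for some nonzero left $K$-vector space $X$ with a basis $(x_j)_{j\in J}$ and some $K$-linear bijection $X\times X\to Y$, is the image of the standard regulus $\{X\times\{0\}\}\cup\{\{(x^{\lambda_k},x)\mid x\in X\}\mid k\in K\}$, where here $\lambda_k\in\mathrm{End}(X)$ is the linear map with $x_j\mapsto kx_j$ (this notion does not depend on the chosen basis). If $A\le Y$ is an element of a regulus $\mathcal R$, then $\mathcal R\setminus\{A\}$ is called an affine regulus (with respect to $A$), with associated regulus $\mathcal R$. A transversal of a regulus is a line of $\mathbb P(K,Y)$ meeting each of its elements in exactly one point; the transversal set is the set of all transversals. *)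

(* Defs.v *)
From HB Require Import structures.
From mathcomp Require Import all_boot all_algebra.
From mathcomp Require Import boolp classical_sets functions.

Set Implicit Arguments.
Unset Strict Implicit.
Unset Printing Implicit Defensive.

Import GRing.Theory.

Local Open Scope classical_set_scope.
Local Open Scope ring_scope.

(* Division rings are unit rings K with [GRing.field_axiom K], which asks that
   nonzero elements be units and does not involve commutativity.  Given
   subspaces of V are bundled ([submodClosed V]), so that Hom(U, W) is the type
   of linear maps between the corresponding modules; subspaces derived from
   them (graphs, images, intersections, ...) are plain sets of vectors of V. *)

Definition submod (K : nzRingType) (V : lmodType K) (S : submodClosed V) : Type :=
  {x : V | x \in S}.

Section SubmodInstances.
Variables (K : nzRingType) (V : lmodType K) (S : submodClosed V).
HB.instance Definition _ := SubChoice.on (submod S).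
HB.instance Definition _ := [SubChoice_isSubLmodule of submod S by <:].
End SubmodInstances.

Section Bases.
Variables (K : nzRingType) (V : lmodType K).

Definition center : set K := [set z | forall k : K, z * k = k * z].

(* An index may occur several times in [s]; this is harmless since [C] is only
   used for the subrings setT and center of K. *)
Definition lin_combs (C : set K) (I : eqType) (b : I -> V) : set V :=
  [set v | exists s : seq (K * I), (forall p, p \in s -> C p.1) /\
             v = \sum_(p <- s) p.1 *: b p.2].

Definition lin_indep (I : eqType) (b : I -> V) : Prop :=
  forall (s : seq I) (c : I -> K), uniq s ->
    \sum_(i <- s) c i *: b i = 0 -> forall i, i \in s -> c i = 0.

Definition is_basis (A : set V) (I : eqType) (b : I -> V) : Prop :=
  lin_indep b /\ lin_combs setT b = A.

Definition has_dim (n : nat) (A : set V) : Prop :=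
  exists b : 'I_n -> V, is_basis A b.

Definition subspaces (Y : set V) : set (set V) :=
  [set A | A `<=` Y /\ GRing.submod_closed (mem A)].

Definition sum_set (A B : set V) : set V := [set x + y | x in A & y in B].

Definition is_direct_sum (A B C : set V) : Prop :=
  sum_set A B = C /\ A `&` B = [set 0].

End Bases.

Arguments center {K}.

Section Lambda.
Variables (K : nzRingType) (X : lmodType K) (I : eqType) (b : I -> X).

Lemma lin_indep_sum (Y : lmodType K) (g : I -> Y) (s : seq (K * I)) :
  lin_indep b -> \sum_(p <- s) p.1 *: b p.2 = 0 ->
  \sum_(p <- s) p.1 *: g p.2 = 0.
Proof.
move=> b_free.
have regroup (Z : lmodType K) (h : I -> Z) : \sum_(p <- s) p.1 *: h p.2 =
    \sum_(i <- undup (unzip2 s)) (\sum_(p <- s | p.2 == i) p.1) *: h i.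
  under [RHS]eq_bigr do rewrite scaler_suml big_mkcond /=.
  rewrite exchange_big /= big_seq_cond [RHS]big_seq_cond.
  apply: eq_bigr => p; rewrite andbT => ps.
  have pU : p.2 \in undup (unzip2 s) by rewrite mem_undup map_f.
  rewrite (bigD1_seq _ pU (undup_uniq _)) /= eqxx big1 ?addr0 // => i.
  by rewrite eq_sym => /negbTE ->.
rewrite !regroup => sb0; rewrite big_seq big1 // => i iU.
by rewrite (b_free _ _ (undup_uniq _) sb0 i iU) scale0r.
Qed.

Hypothesis b_basis : is_basis setT b.

Lemma linear_extension (Y : lmodType K) (g : I -> Y) :
  exists f : {linear X -> Y}, forall i, f (b i) = g i.
Proof.
have [b_free b_span] := b_basis.
have /choice[co coE] (x : X) : exists s : seq (K * I), x = \sum_(p <- s) p.1 *: b p.2.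
  have : [set: X] x by [].
  by rewrite -b_span => -[s [_ xE]]; exists s.
pose f x := \sum_(p <- co x) p.1 *: g p.2.
have fE x (s : seq (K * I)) : x = \sum_(p <- s) p.1 *: b p.2 ->
    f x = \sum_(p <- s) p.1 *: g p.2.
  move=> xE.
  have neg (Z : lmodType K) (h : I -> Z) :
      \sum_(p <- [seq (- p.1, p.2) | p <- s]) p.1 *: h p.2 =
      - \sum_(p <- s) p.1 *: h p.2.
    by rewrite big_map -sumrN; apply: eq_bigr => p _; rewrite scaleNr.
  apply/eqP; rewrite -subr_eq0 -neg /f -big_cat.
  by apply/eqP/lin_indep_sum => //; rewrite big_cat /= neg -coE -xE subrr.
have f_lin : linear f.
  move=> a u v.
  have scal (Z : lmodType K) (h : I -> Z) (s : seq (K * I)) :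
      \sum_(p <- [seq (a * p.1, p.2) | p <- s]) p.1 *: h p.2 =
      a *: \sum_(p <- s) p.1 *: h p.2.
    by rewrite big_map scaler_sumr; apply: eq_bigr => p _; rewrite scalerA.
  rewrite (fE (a *: u + v) ([seq (a * p.1, p.2) | p <- co u] ++ co v)).
    by rewrite big_cat /= scal.
  by rewrite big_cat /= scal -!coE.
pose m := GRing.isLinear.Build K X Y *:%R f f_lin.
pose F : {linear X -> Y} := HB.pack f m.
exists F => i; rewrite /= (fE _ [:: (1, i)]) big_seq1 /= scale1r //.
Qed.

Lemma linear_extension_unique (Y : lmodType K) (f g : {linear X -> Y}) :
  (forall i, f (b i) = g (b i)) -> f =1 g.
Proof.
move=> fg x; have : [set: X] x by [].
rewrite -b_basis.2 => -[s [_ ->]].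
by rewrite !linear_sum; apply: eq_bigr => p _; rewrite !linearZ fg.
Qed.

Definition lambda (k : K) : {linear X -> X} :=
  sval (cid (linear_extension (fun i => k *: b i))).

Lemma lambdaE k i : lambda k (b i) = k *: b i.
Proof. exact: (svalP (cid (linear_extension (fun i => k *: b i)))). Qed.

End Lambda.

Section AffineSpace.
Variables (K : nzRingType) (V : lmodType K) (U W : submodClosed V).

(* [graph_on gamma A] is {u^gamma + u | u \in A} for A <= U. *)
Definition graph_on (gamma : {linear submod U -> submod W}) (A : set V) : set V :=
  [set val (gamma u) + val u | u in [set u : submod U | A (val u)]].

Definition graph (gamma : {linear submod U -> submod W}) : set V :=
  graph_on gamma [set` U].

Definition image_hom (alpha : {linear submod U -> submod W}) : set V :=
  range (fun u => val (alpha u)).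

Definition kernel_hom (alpha : {linear submod U -> submod W}) : set V :=
  [set val u | u in [set u : submod U | alpha u = 0]].

Variables (I : eqType) (b : I -> submod U) (b_basis : is_basis setT b).

(* Maps act on the right in the source, so lambda_k alpha applies lambda_k first. *)
Definition line (alpha beta : {linear submod U -> submod W}) : set (set V) :=
  range (fun k : K => graph ((alpha \o lambda b_basis k) \+ beta)).

Definition central_basis (A : set V) (J : eqType) (c : J -> V) : Prop :=
  is_basis A c /\ forall j, lin_combs center (fun i => val (b i)) (c j).

Definition central (A : set V) : Prop :=
  exists (J : eqType) (c : J -> V), central_basis A c.

End AffineSpace.

Section Projective.
Variables (K : nzRingType) (V : lmodType K).

Definition traces (L : set (set V)) (Y : set V) : set (set V) :=
  [set X `&` Y | X in L].

Definition central_points (J : eqType) (c : J -> V) : set (set V) :=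
  [set range (fun k : K => k *: z) | z in lin_combs center c `\ 0].

Definition proj_isomorphic (V' : lmodType K) (Y : set V) (Y' : set V') : Prop :=
  exists f : set V -> set V',
    set_bij (subspaces Y) (subspaces Y') f /\
    forall A B, subspaces Y A -> subspaces Y B -> (A `<=` B <-> f A `<=` f B).

Definition std_regulus (X : lmodType K) (J : eqType) (x : J -> X)
    (x_basis : is_basis setT x) : set (set (X * X)) :=
  [set setT `*` [set 0]] `|`
  range (fun k : K => range (fun y : X => (lambda x_basis k y, y))).

Definition is_regulus (Y : set V) (R : set (set V)) : Prop :=
  exists (X : lmodType K) (J : eqType) (x : J -> X) (x_basis : is_basis setT x)
         (phi : {linear (X * X)%type -> V}),
    [/\ exists y : X, y != 0, set_bij setT Y phi &
        R = [set phi @` S | S in std_regulus x_basis]].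

Definition associated_regulus (Y A : set V) (L R : set (set V)) : Prop :=
  [/\ is_regulus Y R, R A & L = R `\ A].

Definition is_affine_regulus (Y A : set V) (L : set (set V)) : Prop :=
  exists R, associated_regulus Y A L R.

Definition transversals (Y : set V) (R : set (set V)) : set (set V) :=
  [set T | [/\ has_dim 2 T, T `<=` Y &
     forall A, R A -> exists! P, [/\ has_dim 1 P, P `<=` T & P `<=` A]]].

End Projective.

(* Main.v *)
From HB Require Import structures.
Require Import Defs.
From mathcomp Require Import all_boot all_algebra.
From mathcomp Require Import boolp classical_sets functions.

Set Implicit Arguments.
Unset Strict Implicit.
Unset Printing Implicit Defensive.

Import GRing.Theory.

Local Open Scope classical_set_scope.
Local Open Scope ring_scope.

(** Write X for U' as a left K-module.  Since U' is a complement of ker(alpha)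
    in U, the map (x, y) |-> x^alpha + y is a linear bijection phi from X * X
    onto im(alpha) + U' ([frame], [frame_inj], [range_frame]); it sends
    X * 0, 0 * X and the diagonal to im(alpha), U' and the graph of alpha on U'.
    For k in K the endomorphism lambda_k of U restricts to the lambda_k of any
    central basis of U' ([lambda_central_subspace]), so the traces of the line
    are the images under phi of the sets {(x^lambda_k, x)} ([traces_line]).
    Together with im(alpha) they are the image of the standard regulus.

    Uniqueness rests on three facts about reguli in X * X.

    First, the standard regulus of a basis consists of the spaces
    {(y^lambda_p, y^lambda_q)}, with (p, q) a point of the projective line over
    K ([std_regulus_slots]).  The linear group of K^2 acts 3-transitively on
    these points, so a regulus that contains X * 0, 0 * X and the diagonal is
    the standard regulus of some basis of X ([regulus_normal_form]).

    Next, a transversal T of such a regulus contains (y, 0) and (0, y) for some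
    nonzero y, and meeting the element of parameter k forces y^lambda_k to lie
    in K y.  A common eigenvector of all lambda_k is a multiple of a vector z
    with z^lambda_k = k z for all k ([eigenvector_center]), and such vectors z
    are exactly the Z-linear combinations of the basis ([lin_combs_centerP]).
    So the transversals correspond to the points K z ([sum_transversals]).

    Finally, let two bases x and x' of X satisfy that each nonzero Z-combination
    of x' is a multiple of one of x.  Comparing the eigenvalues of x'_i, x'_j
    and x'_i + x'_j gives one nonzero h in K such that all h^-1 x'_j are
    Z-combinations of x.  Then lambda_k for x is lambda_(h k h^-1) for x', and
    the two standard reguli coincide ([std_regulus_eq]). *)

(** * The maps lambda_k and the Z-span of a basis *)

Section Lambda.
Variables (K : nzRingType) (X : lmodType K) (I : eqType) (b : I -> X).
Hypothesis b_basis : is_basis setT b.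

Lemma basis_expansion x : exists s : seq (K * I), x = \sum_(p <- s) p.1 *: b p.2.
Proof.
have : [set: X] x by [].
by rewrite -b_basis.2 => -[s [_ xE]]; exists s.
Qed.

Lemma lambdaD k l x :
  lambda b_basis (k + l) x = lambda b_basis k x + lambda b_basis l x.
Proof.
apply: (linear_extension_unique b_basis
  (g := (lambda b_basis k \+ lambda b_basis l))) => i /=.
by rewrite !lambdaE scalerDl.
Qed.

(** lambda_k multiplies coordinates by k on the right, since k enters between a
    coefficient and its basis vector; hence the order of the factors. *)
Lemma lambdaM k l x :
  lambda b_basis (k * l) x = lambda b_basis l (lambda b_basis k x).
Proof.
apply: (linear_extension_unique b_basis
  (g := (lambda b_basis l \o lambda b_basis k))) => i /=.
by rewrite !lambdaE linearZ /= lambdaE scalerA.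
Qed.

Lemma lambda0 x : lambda b_basis 0 x = 0.
Proof.
apply: (linear_extension_unique b_basis (g := \0)) => i /=.
by rewrite lambdaE scale0r.
Qed.

Lemma lambda1 x : lambda b_basis 1 x = x.
Proof.
apply: (linear_extension_unique b_basis (g := idfun)) => i /=.
by rewrite lambdaE scale1r.
Qed.

(** K^o is K as a left module over itself, so that coordinates are linear maps
    even when K is not commutative. *)
Definition coord (i : I) : {linear X -> K^o} :=
  sval (cid (linear_extension b_basis (fun j => (j == i)%:R : K^o))).

Lemma coordE i j : coord i (b j) = (j == i)%:R.
Proof.
exact: (svalP (cid (linear_extension b_basis (fun j => (j == i)%:R : K^o)))).
Qed.

Lemma coord_expansion x : exists s : seq I, x = \sum_(i <- s) coord i x *: b i.
Proof.
have [s xE] := basis_expansion x; exists (undup (unzip2 s)).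
under eq_bigr => i _.
  rewrite [in coord i x]xE linear_sum scaler_suml.
  under eq_bigr do rewrite linearZ /= coordE -scalerA.
  over.
rewrite exchange_big [LHS]xE /= big_seq [RHS]big_seq; apply: eq_bigr => p ps.
have pU : p.2 \in undup (unzip2 s) by rewrite mem_undup map_f.
rewrite -scaler_sumr (bigD1_seq _ pU (undup_uniq _)) /= eqxx scale1r.
by rewrite big1 ?addr0 // => i; rewrite eq_sym => /negbTE ->; rewrite scale0r.
Qed.

Lemma coord_eq0 x : (forall i, coord i x = 0) -> x = 0.
Proof.
move=> x0; have [s ->] := coord_expansion x.
by rewrite big1 // => i _; rewrite x0 scale0r.
Qed.

(** In coordinates lambda_k is right multiplication by k, whereas scaling by k
    is left multiplication; the two agree on a vector only if its coordinates
    commute with k, which is the idea of [lin_combs_centerP]. *)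
Lemma coord_lambda i k x : coord i (lambda b_basis k x) = coord i x * k.
Proof.
have [s ->] := basis_expansion x; rewrite !linear_sum mulr_suml.
apply: eq_bigr => p _; rewrite !linearZ /= lambdaE linearZ /= coordE.
rewrite -[RHS]scalerAl; congr (_ *: _); rewrite -[LHS]/(k * _).
by case: eqP => _; rewrite ?mulr0 ?mul0r ?mul1r ?mulr1.
Qed.

(** A description of the Z-span that does not mention the basis, except through
    the maps lambda_k. *)
Lemma lin_combs_centerP x :
  lin_combs center b x <-> forall k, lambda b_basis k x = k *: x.
Proof.
split=> [[s [sZ ->]] k | xP].
  rewrite linear_sum scaler_sumr big_seq [RHS]big_seq; apply: eq_bigr => p ps.
  by rewrite linearZ /= lambdaE !scalerA (sZ _ ps k).
have [s xE] := coord_expansion x.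
exists [seq (coord i x, i) | i <- s]; split=> [p /mapP[i _ ->] k /=|].
  by rewrite -coord_lambda xP linearZ.
by rewrite big_map.
Qed.

Lemma lin_combs_center_basis i : lin_combs center b (b i).
Proof. by apply/lin_combs_centerP => k; rewrite lambdaE. Qed.

Lemma lin_combs_centerD x y :
  lin_combs center b x -> lin_combs center b y -> lin_combs center b (x + y).
Proof.
move=> /lin_combs_centerP xP /lin_combs_centerP yP.
by apply/lin_combs_centerP => k; rewrite linearD xP yP scalerDr.
Qed.

Lemma basis_image (V : lmodType K) (g : {linear X -> V}) :
  injective g -> is_basis (range g) (g \o b).
Proof.
move=> g_inj; split.
  move=> s c s_uniq; rewrite /= => s0; apply: (b_basis.1) => //; apply: g_inj.
  by rewrite linear0 linear_sum -[RHS]s0; apply: eq_bigr => i _; rewrite linearZ.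
apply/seteqP; split=> [v [s [_ ->]] | v [x _ <-]].
  exists (\sum_(p <- s) p.1 *: b p.2) => //.
  by rewrite linear_sum; apply: eq_bigr => i _; rewrite linearZ.
have [s ->] := basis_expansion x; exists s; split=> //.
by rewrite linear_sum; apply: eq_bigr => i _; rewrite linearZ.
Qed.

End Lambda.

Section Conjugation.
Variables (K : nzRingType) (X X' : lmodType K) (I : eqType).
Variables (b : I -> X) (b' : I -> X').
Hypotheses (bB : is_basis setT b) (bB' : is_basis setT b').
Variable g : {linear X -> X'}.

Lemma lambda_conj : (forall i, g (b i) = b' i) ->
  forall k x, g (lambda bB k x) = lambda bB' k (g x).
Proof.
move=> gb k.
apply: (linear_extension_unique bB (f := g \o lambda bB k)
  (g := lambda bB' k \o g)) => i /=.
by rewrite lambdaE linearZ /= gb lambdaE.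
Qed.

End Conjugation.

(** * Points and planes over a division ring *)

Section DivisionRing.
Variables (K : unitRingType) (K_div : GRing.field_axiom K).

Lemma div_mulVr (h : K) : h != 0 -> h^-1 * h = 1.
Proof. by move=> /K_div; exact: mulVr. Qed.
Lemma div_mulrV (h : K) : h != 0 -> h * h^-1 = 1.
Proof. by move=> /K_div; exact: mulrV. Qed.

Lemma div_inv_neq0 (h : K) : h != 0 -> h^-1 != 0.
Proof.
move=> h0; apply/eqP => hV; have /eqP := div_mulVr h0.
by rewrite hV mul0r eq_sym oner_eq0.
Qed.

Section Module.
Variable V : lmodType K.

Lemma div_scalerK (h : K) (v : V) : h != 0 -> h^-1 *: (h *: v) = v.
Proof. by move=> h0; rewrite scalerA div_mulVr // scale1r. Qed.
Lemma div_scalerVK (h : K) (v : V) : h != 0 -> h *: (h^-1 *: v) = v.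
Proof. by move=> h0; rewrite scalerA div_mulrV // scale1r. Qed.

Lemma div_scaler_eq0 (h : K) (v : V) : h *: v = 0 -> v <> 0 -> h = 0.
Proof.
move=> hv v0; apply/eqP; apply: contra_notT v0 => h0.
by rewrite -(div_scalerK v h0) hv scaler0.
Qed.

(** Steinitz exchange in dimension two: independent vectors of a plane span it.
    It serves both for transversals and for the parameter space K^2. *)
Lemma plane_spanned (e f u w : V) :
  (exists x y, u = x *: e + y *: f) -> (exists x y, w = x *: e + y *: f) ->
  (forall x y, x *: u + y *: w = 0 -> x = 0 /\ y = 0) ->
  forall v, (exists x y, v = x *: e + y *: f) ->
    exists x y, v = x *: u + y *: w.
Proof.
move=> [a [c uE]] [d [d' wE]] uw.
(* Symmetric in e and f, so that e may be assumed to occur in u. *)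
wlog a0 : e f a c d d' uE wE / a != 0.
  move=> main v [x [y vE]]; have [a0|a0] := eqVneq a 0; last first.
    by apply: (main e f a c d d') => //; exists x, y.
  have [c0|c0] := eqVneq c 0; last first.
    apply: (main f e c a d' d) => //; rewrite 1?addrC //.
    by exists y, x; rewrite addrC.
  have [] := uw 1 0; last by move/eqP; rewrite oner_eq0.
  by rewrite uE a0 c0 !scale0r !addr0 scaler0.
have eE : e = a^-1 *: u - (a^-1 * c) *: f.
  by rewrite uE scalerDr div_scalerK // scalerA addrK.
have {d d' wE} [d [m wE]] : exists d m, w = d *: u + m *: f.
  exists (d * a^-1), (d' - d * (a^-1 * c)).
  by rewrite wE eE scalerBr scalerBl !scalerA addrAC addrA.
have m0 : m != 0.
  apply/eqP => m0; have [] := uw d (- 1).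
    by rewrite wE m0 scale0r addr0 scaleN1r subrr.
  by move=> _ /eqP; rewrite oppr_eq0 oner_eq0.
have fE : f = (- (m^-1 * d)) *: u + m^-1 *: w.
  by rewrite wE scalerDr div_scalerK // scalerA scaleNr addKr.
move=> v [x [y ->]]; pose n := y - x * (a^-1 * c).
have -> : x *: e + y *: f = (x * a^-1) *: u + n *: f.
  by rewrite eE scalerBr scalerBl !scalerA -addrA [- _ + _]addrC.
exists (x * a^-1 + n * (- (m^-1 * d))), (n * m^-1).
by rewrite [in LHS]fE scalerDr scalerDl !scalerA addrA.
Qed.

Lemma has_dim1P (P : set V) :
  has_dim 1 P -> exists2 p, p <> 0 & P = range (fun k : K => k *: p).
Proof.
move=> [e [e_free <-]]; exists (e ord0).
  move=> e0; have := e_free [:: ord0] (fun=> 1) isT.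
  rewrite big_seq1 e0 scaler0 => /(_ erefl ord0); rewrite inE eqxx => /(_ isT) /eqP.
  by rewrite oner_eq0.
apply/seteqP; split=> [v [s [_ ->]] | v [k _ <-]].
  exists (\sum_(p <- s) p.1) => //; rewrite scaler_suml; apply: eq_bigr => p _.
  by rewrite (ord1 p.2).
by exists [:: (k, ord0)]; split=> //; rewrite big_seq1.
Qed.

Lemma has_dim_point (p : V) : p <> 0 -> has_dim 1 (range (fun k : K => k *: p)).
Proof.
move=> p0; exists (fun=> p); split.
  move=> [|i [|j s]] c // su; last by rewrite /= (ord1 i) (ord1 j) inE eqxx in su.
  by rewrite big_seq1 => cp j; rewrite inE => /eqP ->; apply: div_scaler_eq0 cp p0.
apply/seteqP; split=> [v [s [_ ->]] | v [k _ <-]].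
  by exists (\sum_(p <- s) p.1) => //; rewrite scaler_suml.
by exists [:: (k, ord0)]; split=> //; rewrite big_seq1.
Qed.

Lemma has_dim2P (T : set V) : has_dim 2 T ->
  exists e f, T = [set v | exists x y, v = x *: e + y *: f].
Proof.
move=> [e [_ <-]]; exists (e ord0), (e ord_max).
apply/seteqP; split=> [v [s [_ ->]] | v [x [y ->]]].
  elim: s => [|[k i] s [x [y ss]]].
    by exists 0, 0; rewrite big_nil !scale0r addr0.
  rewrite big_cons ss /=; case: (unliftP ord0 i) => [j|] ->.
    have -> : lift ord0 j = ord_max by apply: val_inj; rewrite (ord1 j).
    by exists x, (k + y); rewrite scalerDl addrCA.
  by exists (k + x), y; rewrite scalerDl addrA.
by exists [:: (x, ord0); (y, ord_max)]; split=> //; rewrite big_cons big_seq1.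
Qed.

Lemma has_dim_plane (e f : V) :
  (forall x y, x *: e + y *: f = 0 -> x = 0 /\ y = 0) ->
  has_dim 2 [set v | exists x y, v = x *: e + y *: f].
Proof.
move=> ef; pose g (i : 'I_2) := if i == ord0 then e else f.
exists g; split.
  move=> s c su s0 i si.
  have : \sum_(i : 'I_2) (if i \in s then c i else 0) *: g i = 0.
    rewrite -[RHS]s0 [RHS]big_uniq //= [RHS]big_mkcond; apply: eq_bigr => j _.
    by case: ifP; rewrite ?scale0r.
  rewrite big_ord_recl big_ord1 /g /= => /ef [].
  case: (unliftP ord0 i) => [j|] iE; rewrite {}iE in si *; last by rewrite si.
  by move=> _; rewrite (ord1 j) in si *; rewrite si.
apply/seteqP; split=> [v [s [_ ->]] | v [x [y ->]]].
  elim: s => [|[k i] s [x [y ss]]].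
    by exists 0, 0; rewrite big_nil !scale0r addr0.
  rewrite big_cons ss /= /g; case: ifP => _.
    by exists (k + x), y; rewrite scalerDl addrA.
  by exists x, (k + y); rewrite scalerDl addrCA.
by exists [:: (x, ord0); (y, ord_max)]; split=> //; rewrite big_cons big_seq1.
Qed.

(** Reduces meeting in exactly one point to the computation of an
    intersection. *)
Lemma unique_point (T A : set V) p : p <> 0 ->
  T `&` A = range (fun k : K => k *: p) ->
  exists! P, [/\ has_dim 1 P, P `<=` T & P `<=` A].
Proof.
move=> p0 TA; exists (range (fun k : K => k *: p)); split.
  by split; [exact: has_dim_point | rewrite -TA; apply: subIsetl
    | rewrite -TA; apply: subIsetr].
move=> P [/has_dim1P[q q0 PE] PT PA].
have : (T `&` A) q.
  by split; [apply: PT | apply: PA]; rewrite PE; exists 1; rewrite ?scale1r.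
rewrite TA => -[h _ hE]; have h0 : h != 0.
  by apply/eqP => h0; apply: q0; rewrite -hE h0 scale0r.
rewrite PE -hE; apply/seteqP; split=> v [k _ <-].
  by exists (k * h^-1) => //; rewrite -scalerA div_scalerK.
by exists (k * h) => //; rewrite scalerA.
Qed.

End Module.

(** * The standard regulus in homogeneous coordinates *)

Section StandardRegulus.
Variables (X : lmodType K) (J : eqType) (x : J -> X).
Hypothesis xB : is_basis setT x.

(** The image of [slot a] is the element of the standard regulus whose parameter
    has homogeneous coordinates a = (a1, a2); in terms of K^2 (x) X it consists
    of the sums of the vectors y_j a (x) x_j. *)
Definition slot (a : K^o * K^o) (y : X) : X * X :=
  (lambda xB a.1 y, lambda xB a.2 y).

Lemma slot_is_linear a : linear (slot a).
Proof. by move=> k u v; rewrite /slot !linearP. Qed.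

HB.instance Definition _ a :=
  GRing.isLinear.Build K X (X * X)%type *:%R (slot a) (slot_is_linear a).

Lemma slotD a a' y : slot (a + a') y = slot a y + slot a' y.
Proof. by rewrite /slot !lambdaD. Qed.

Lemma slotZ (h : K) a y : slot (h *: a) y = slot a (lambda xB h y).
Proof. by rewrite /slot !lambdaM. Qed.

Lemma lambda_surj h y : h != 0 -> exists z, lambda xB h z = y.
Proof.
by move=> h0; exists (lambda xB h^-1 y); rewrite -lambdaM div_mulVr // lambda1.
Qed.

Lemma lambda_inj h : h != 0 -> injective (lambda xB h).
Proof.
move=> h0; apply: (can_inj (g := lambda xB h^-1)) => y.
by rewrite -lambdaM div_mulrV // lambda1.
Qed.

Lemma slot_inj a : a != 0 -> injective (slot a).
Proof.
case: a => a1 a2; have [->|a10 _] := eqVneq a1 0; last first.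
  by move=> y z [] /(lambda_inj a10).
have [->|a20 _] := eqVneq a2 0; first by rewrite eqxx.
by move=> y z [_] /(lambda_inj a20).
Qed.

Lemma scale_pair (h a1 a2 : K) :
  h *: ((a1, a2) : K^o * K^o) = (h * a1, h * a2).
Proof. by []. Qed.

Lemma slot_scale h a : h != 0 -> range (slot (h *: a)) = range (slot a).
Proof.
move=> h0; apply/seteqP; split=> v [y _ <-].
  by rewrite slotZ; exists (lambda xB h y).
by have [z <-] := lambda_surj y h0; exists z; rewrite ?slotZ.
Qed.

Lemma slot_infty : range (slot (1, 0)) = setT `*` [set 0].
Proof.
apply/seteqP; split=> [v [y _ <-] | [u v] [/= _ ->]].
  by split=> //=; rewrite lambda0.
by exists u; rewrite // /slot lambda0 lambda1.
Qed.

Lemma slot_affine k : slot (k, 1) = fun y => (lambda xB k y, y).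
Proof. by apply/funext => y; rewrite /slot lambda1. Qed.

(** The parameter k of {(y^lambda_k, y)} is the point (k, 1), and X * 0 is the
    point (1, 0) at infinity.  In these coordinates no element of the regulus is
    exceptional. *)
Lemma std_regulus_slots :
  std_regulus xB = [set range (slot a) | a in [set a | a != 0]].
Proof.
apply/seteqP; split=> [S [-> | [k _ <-]] | S [[a1 a2] /= a0 <-]].
- exists (1, 0); last exact: slot_infty.
  by rewrite /= -pair_eqE /= oner_eq0.
- exists (k, 1); last by rewrite slot_affine.
  by rewrite /= -pair_eqE /= oner_eq0 andbF.
have [a20|a20] := eqVneq a2 0.
  left; have a10 : a1 != 0 by apply: contraNneq a0 => ->; rewrite a20.
  by rewrite -slot_infty -(slot_scale (1, 0) a10) a20 scale_pair mulr1 mulr0.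
right; exists (a2^-1 * a1) => //.
rewrite -slot_affine -(slot_scale (a1, a2) (div_inv_neq0 a20)).
by rewrite scale_pair div_mulVr.
Qed.

Lemma pair_combination (P Q a : K^o * K^o) :
  (forall s t : K, s *: P + t *: Q = 0 -> s = 0 /\ t = 0) ->
  exists s t : K, a = s *: P + t *: Q.
Proof.
have spanE (v : K^o * K^o) :
    exists s t : K, v = s *: ((1, 0) : K^o * K^o) + t *: ((0, 1) : K^o * K^o).
  exists v.1, v.2; case: v => v1 v2; rewrite -[RHS]/(_ * _ + _ * _, _ * _ + _ * _).
  by rewrite !mulr1 !mulr0 addr0 add0r.
by move=> PQ; apply: plane_spanned PQ _ _; apply: spanE.
Qed.

(** If P and Q were proportional, [slot_scale] would identify their elements. *)
Lemma slot_independent (P Q : K^o * K^o) : P != 0 -> Q != 0 ->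
  range (slot P) <> range (slot Q) ->
  forall s t : K, s *: P + t *: Q = 0 -> s = 0 /\ t = 0.
Proof.
move=> P0 Q0 PQ s t st0.
have [s0|s0] := eqVneq s 0.
  split=> //; move: st0; rewrite s0 scale0r add0r => tQ.
  by apply: (div_scaler_eq0 tQ) => /eqP; rewrite (negbTE Q0).
have [t0|t0] := eqVneq t 0.
  by move: st0; rewrite t0 scale0r addr0 => /div_scaler_eq0 -> //; apply/eqP.
have sP : s *: P = - t *: Q.
  by rewrite scaleNr; apply/eqP; rewrite -addr_eq0 st0.
by case: PQ; rewrite -(slot_scale P s0) sP slot_scale ?oppr_eq0.
Qed.

End StandardRegulus.

(** The three given elements have parameters P, Q and D = s P + t Q with s and t
    nonzero.  Rescaled to D = P + Q, the coordinates of a parameter with respect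
    to P and Q replace the standard ones: theta turns the slots of P and Q into
    (g y, 0) and (0, g y) with the same g, by the diagonal condition, and the
    image under g of the basis is the required one. *)
Lemma regulus_normal_form (Y X : lmodType K) (J : eqType) (y : J -> Y)
    (yB : is_basis setT y) (theta : {linear (Y * Y)%type -> (X * X)%type}) :
  (exists u : X, u != 0) -> bijective theta ->
  let R := [set theta @` S | S in std_regulus yB] in
  R (setT `*` [set 0]) -> R ([set 0] `*` setT) ->
  R (range (fun u : X => (u, u))) ->
  exists (x : J -> X) (xB : is_basis setT x), R = std_regulus xB.
Proof.
move=> [u0 u00] theta_bij R.
have theta_inj : injective theta := bij_inj theta_bij.
rewrite /R std_regulus_slots.
move=> [_ [P P0 <-] RP] [_ [Q Q0 <-] RQ] [_ [D D0 <-] RD].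
have indepPQ := @slot_independent _ _ _ yB P Q P0 Q0.
have {}indepPQ : forall s t : K, s *: P + t *: Q = 0 -> s = 0 /\ t = 0.
  apply: indepPQ => PQ; have : (setT `*` [set 0]) (u0, 0 : X) by [].
  by rewrite -RP PQ RQ => -[/= /eqP]; rewrite (negbTE u00).
have [s [t DE]] := pair_combination D indepPQ.
have s0 : s != 0.
  apply: contraPneq RQ => s0; rewrite DE s0 scale0r add0r in RD D0.
  have t0 : t != 0 by apply: contraNneq D0 => ->; rewrite scale0r.
  rewrite (slot_scale yB Q t0) in RD; rewrite RD => RQ.
  have : range (fun u : X => (u, u)) (u0, u0) by exists u0.
  by rewrite RQ => -[/= /eqP]; rewrite (negbTE u00).
have t0 : t != 0.
  apply: contraPneq RP => t0; rewrite DE t0 scale0r addr0 in RD.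
  rewrite (slot_scale yB P s0) in RD; rewrite RD => RP.
  have : range (fun u : X => (u, u)) (u0, u0) by exists u0.
  by rewrite RP => -[/= _ /eqP]; rewrite (negbTE u00).
(* Rescale P and Q so that the third parameter becomes P + Q. *)
rewrite -(slot_scale yB P s0) in RP; rewrite -(slot_scale yB Q t0) in RQ.
have indep' : forall h k : K, h *: (s *: P) + k *: (t *: Q) = 0 -> h = 0 /\ k = 0.
  move=> h k; rewrite !scalerA => /indepPQ[hs kt]; split.
    by rewrite -[h]mulr1 -(div_mulrV s0) mulrA hs mul0r.
  by rewrite -[k]mulr1 -(div_mulrV t0) mulrA kt mul0r.
move: (s *: P) (t *: Q) DE RP RQ indep' => {P Q P0 Q0 indepPQ s t s0 t0}.
move=> P Q DE RP RQ indepPQ; rewrite {D}DE in RD D0.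
pose g : {linear Y -> X} := snd \o theta \o slot yB Q.
have Q0 : Q != 0.
  apply/eqP => Q0; have [] := indepPQ 0 1; first by rewrite Q0 scaler0 scale0r addr0.
  by move=> _ /eqP; rewrite oner_eq0.
have thetaQ z : theta (slot yB Q z) = (0, g z).
  have : ([set 0] `*` setT) (theta (slot yB Q z)).
    by rewrite -RQ; exists (slot yB Q z) => //; exists z.
  by rewrite /g /=; case: (theta _) => u v [/= ->].
have thetaP z : theta (slot yB P z) = (g z, 0).
  have : (setT `*` [set 0]) (theta (slot yB P z)).
    by rewrite -RP; exists (slot yB P z) => //; exists z.
  have : range (fun u : X => (u, u)) (theta (slot yB (P + Q) z)).
    by rewrite -RD; exists (slot yB (P + Q) z) => //; exists z.
  rewrite slotD linearD thetaQ; case: (theta _) => u v [w _] [wu wv] [/= _ v0].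
  by move: wu wv; rewrite v0 add0r addr0 => -> ->.
have g_inj : injective g.
  move=> z z' gz; apply: (slot_inj (xB := yB) Q0); apply: theta_inj.
  by rewrite !thetaQ gz.
have g_surj : range g = setT.
  apply/seteqP; split=> // u _; have : ([set 0] `*` setT) (0 : X, u) by [].
  by rewrite -RQ => -[_ [z _ <-]]; rewrite thetaQ => -[<-]; exists z.
have xB := basis_image yB g_inj; rewrite g_surj in xB.
have slotPQ k : theta @` range (slot yB (k *: P + Q)) =
    range (fun u => (lambda xB k u, u)).
  rewrite image_comp; apply/seteqP; split=> v [z _ <-] /=.
    exists (g z) => //; rewrite slotD slotZ linearD thetaP thetaQ.
    by rewrite -(lambda_conj yB xB) // -[RHS]/(_ + _, _ + _) addr0 add0r.
  have : [set: X] z by [].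
  rewrite -g_surj => -[z' _ <-]; exists z' => //=.
  rewrite slotD slotZ linearD thetaP thetaQ.
  by rewrite -(lambda_conj yB xB) // -[LHS]/(_ + _, _ + _) addr0 add0r.
exists (g \o y), xB; apply/seteqP; split=> [S [_ [a a0 <-] <-] | S [-> | [k _ <-]]].
- have [s [t aE]] := pair_combination a indepPQ.
  have [t0|t0] := eqVneq t 0.
    left; rewrite -RP aE t0 scale0r addr0 slot_scale //.
    by apply: contraNneq a0 => s0; rewrite aE t0 s0 !scale0r addr0.
  right; exists (t^-1 * s) => //; rewrite -slotPQ.
  rewrite -(slot_scale yB a (div_inv_neq0 t0)).
  by rewrite aE scalerDr !scalerA div_mulVr // scale1r.
- exists (range (slot yB P)) => //; exists P => //=.
  apply/eqP => P0; have [] := indepPQ 1 0; first by rewrite P0 scaler0 scale0r addr0.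
  by move/eqP; rewrite oner_eq0.
- exists (range (slot yB (k *: P + Q))) => //; exists (k *: P + Q) => //=.
  apply/eqP => kPQ0; have [] := indepPQ k 1; first by rewrite scale1r.
  by move=> _ /eqP; rewrite oner_eq0.
Qed.

(** * Bases with the same Z-points *)

Section Comparison.
Variables (X : lmodType K) (J J' : eqType) (x : J -> X) (x' : J' -> X).
Hypotheses (xB : is_basis setT x) (xB' : is_basis setT x').

(** Conjugation by h permutes the parameters k, so it changes the indexing of
    the regulus but not the regulus. *)
Lemma conjugate_lambda_std_regulus (h : K) : h != 0 ->
  (forall k j, lambda xB k (x' j) = (h * k * h^-1) *: x' j) ->
  std_regulus xB = std_regulus xB'.
Proof.
move=> h0 hP.
have lE k : lambda xB k =1 lambda xB' (h * k * h^-1).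
  by apply: (linear_extension_unique xB') => j; rewrite hP lambdaE.
congr (_ `|` _); apply/seteqP; split=> S [k _ <-].
  exists (h * k * h^-1) => //; congr (_ @` _).
  by apply/funext => y; rewrite lE.
exists (h^-1 * k * h) => //; congr (_ @` _); apply/funext => y.
by rewrite lE !mulrA div_mulrV // mul1r -mulrA div_mulrV // mulr1.
Qed.

(** A multiple c z of a Z-combination z satisfies
    (c z)^lambda_k = (c k c^-1) (c z), so every x'_j is an eigenvector of all
    lambda_k.  One inclusion between the sets of points is enough: sums of two
    basis vectors are eigenvectors as well, and this ties the factors c of
    distinct x'_j together. *)
Lemma std_regulus_eq : (exists u : X, u != 0) ->
  (forall z, lin_combs center x' z -> z <> 0 ->
     exists h z', lin_combs center x z' /\ z = h *: z') ->
  std_regulus xB = std_regulus xB'.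
Proof.
move=> [u0 u00] Zx'x.
have [i] : exists i : J', True.
  apply: contrapT => noJ; move/eqP: u00; apply.
  by apply: (coord_eq0 (b_basis := xB')) => i; case: noJ; exists i.
have x'0 j : x' j <> 0.
  move=> xj0; have := xB'.1 [:: j] (fun=> 1) isT.
  rewrite big_seq1 xj0 scaler0 => /(_ erefl j); rewrite inE eqxx => /(_ isT) /eqP.
  by rewrite oner_eq0.
move=> _; have [h [z [zZ xiE]]] := Zx'x _ (lin_combs_center_basis xB' i) (@x'0 i).
have h0 : h != 0.
  by apply/eqP => h0; apply: (@x'0 i); rewrite xiE h0 scale0r.
apply: (conjugate_lambda_std_regulus h0) => k j.
suff : lambda xB k (h^-1 *: x' j) = k *: (h^-1 *: x' j).
  rewrite linearZ /= => /(congr1 (fun v => h *: v)).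
  by rewrite div_scalerVK // !scalerA.
have zP := (lin_combs_centerP xB z).1 zZ.
have [->|ij] := eqVneq j i; first by rewrite xiE div_scalerK.
have [m [w [wZ xjE]]] := Zx'x _ (lin_combs_center_basis xB' j) (@x'0 j).
have ij_free c d : c *: x' i + d *: x' j = 0 -> c = 0 /\ d = 0.
  move=> cd0; have := xB'.1 [:: i; j] (fun l => if l == i then c else d).
  rewrite /= inE eq_sym ij big_cons big_seq1 eqxx (negbTE ij) => /(_ isT cd0) H.
  have := H i; have := H j; rewrite !inE !eqxx orbT (negbTE ij).
  by move=> /(_ isT) -> /(_ isT).
have sum0 : x' i + x' j <> 0.
  move=> s0; have [] := ij_free 1 1; first by rewrite !scale1r.
  by move/eqP; rewrite oner_eq0.
have [n [v [vZ sE]]] := Zx'x _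
  (lin_combs_centerD xB' (lin_combs_center_basis xB' i)
     (lin_combs_center_basis xB' j)) sum0.
have m0 : m != 0 by apply/eqP => m0; apply: (@x'0 j); rewrite xjE m0 scale0r.
have n0 : n != 0 by apply/eqP => n0; apply: sum0; rewrite sE n0 scale0r.
have eigen c y : c != 0 -> lin_combs center x y ->
    exists mu, lambda xB k (h^-1 *: (c *: y)) = mu *: (h^-1 *: (c *: y)).
  move=> c0 /(lin_combs_centerP xB) yZ; exists (h^-1 * c * k * (c^-1 * h)).
  rewrite !linearZ /= yZ !scalerA; congr (_ *: y).
  by rewrite -!mulrA (mulrA h) div_mulrV // mul1r div_mulVr // mulr1.
(* As z = h^-1 x'_i, d = h^-1 x'_j and z + d are eigenvectors and z, d are
   independent, the eigenvalue k of z is also that of d. *)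
have [nu] := eigen n v n0 vZ; have [mu] := eigen m w m0 wZ.
rewrite -xjE -sE => jP.
rewrite scalerDr linearD jP [in X in X -> _]xiE div_scalerK // zP.
rewrite scalerDr => /eqP.
rewrite -subr_eq0 opprD addrACA -!scalerBl -[z](div_scalerK z h0) -xiE.
have cancel c : c * h^-1 = 0 -> c = 0.
  by move=> ch; rewrite -[c]mulr1 -(div_mulVr h0) mulrA ch mul0r.
rewrite !scalerA => /eqP/ij_free[/cancel/eqP + /cancel/eqP].
by rewrite !subr_eq0 => /eqP -> /eqP ->.
Qed.

End Comparison.

(** * Transversals of the image of a standard regulus *)

Section Transversals.
Variables (V X : lmodType K) (J : eqType) (x : J -> X).
Hypothesis xB : is_basis setT x.
Variable phi : {linear (X * X)%type -> V}.
Hypothesis phi_inj : injective phi.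

Let im : set V := phi @` (setT `*` [set 0]).
Let R : set (set V) := [set phi @` S | S in std_regulus xB].
Let plane (z : X) : set V :=
  [set v | exists a d : K, v = a *: phi (z, 0) + d *: phi (0, z)].

Lemma scale_phi (h : K) y z : h *: phi (y, z) = phi (h *: y, h *: z).
Proof. by rewrite -linearZ. Qed.

Lemma add_phi u v y z : phi (u, v) + phi (y, z) = phi (u + y, v + z).
Proof. by rewrite -linearD. Qed.

Lemma linear_pair (a d : K) (y z : X) :
  a *: phi (y, 0) + d *: phi (0, z) = phi (a *: y, d *: z).
Proof.
by rewrite !scale_phi add_phi !scaler0 addr0 add0r.
Qed.

(** If z^lambda_k = k z then the plane of the pairs (a z, d z) meets
    {(y^lambda_k, y)} in the point of (k z, z). *)
Lemma central_plane_transversal z : lin_combs center x z -> z <> 0 ->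
  transversals (range phi) R (plane z).
Proof.
move=> /(lin_combs_centerP xB) zP z0; split.
- apply: has_dim_plane => a d; rewrite linear_pair -(linear0 phi) => /phi_inj.
  by move=> [] /div_scaler_eq0 -> // /div_scaler_eq0 ->.
- by move=> _ [a [d ->]]; rewrite linear_pair; exists (a *: z, d *: z).
move=> _ [S SR <-]; case: SR => [->|[k _ <-]].
  apply: (unique_point (p := phi (z, 0))).
    by rewrite -(linear0 phi) => /phi_inj [].
  apply/seteqP; split=> v.
    move=> [[a [d ->]]]; rewrite linear_pair => -[[u w] [/= _ ->]] /phi_inj[_ <-].
    by exists a => //; rewrite scale_phi scaler0.
  move=> [a _ <-]; split; first by exists a, 0; rewrite scale0r addr0.
  by exists (a *: z, 0); rewrite // scale_phi scaler0.
apply: (unique_point (p := phi (k *: z, z))).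
  by rewrite -(linear0 phi) => /phi_inj [].
apply/seteqP; split=> v.
  move=> [[a [d ->]]]; rewrite linear_pair => -[_ [u _ <-]] /phi_inj[+ ud].
  rewrite ud linearZ /= zP => <-.
  by exists d => //; rewrite -linearZ.
move=> [a _ <-]; split.
  by exists (a * k), a; rewrite linear_pair -linearZ -scalerA.
exists (lambda xB k (a *: z), a *: z); first by exists (a *: z).
by rewrite linearZ /= zP -linearZ.
Qed.

(** Divide y by one of its nonzero coordinates.  The quotient has a coordinate 1,
    where lambda_k acts as multiplication by k, so k is its eigenvalue. *)
Lemma eigenvector_center y : y <> 0 ->
  (forall k, exists m, lambda xB k y = m *: y) ->
  exists h z, [/\ h != 0, lin_combs center x z & y = h *: z].
Proof.
move=> y0 yP.
have [i yi] : exists i, coord xB i y != 0.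
  apply: contrapT => no; apply: y0; apply: (coord_eq0 (b_basis := xB)) => i.
  by apply/eqP; apply: contra_notT no => yi; exists i.
pose c : K := coord xB i y; have c0 : c != 0 by [].
exists c, (c^-1 *: y); split=> //; last by rewrite div_scalerVK.
apply/(lin_combs_centerP xB) => k.
have [m kE] := yP k; rewrite linearZ /= kE !scalerA; congr (_ *: _).
have : c * k = m * c by rewrite -coord_lambda kE linearZ.
move=> ck; rewrite -[LHS]mulr1 -(div_mulrV c0) !mulrA -(mulrA _ m) -ck.
by rewrite mulrA div_mulVr // mul1r.
Qed.

(** The points of T on X * 0, on 0 * X and on the diagonal, the latter spanned by
    (y, y), are dependent because T is a plane; hence T contains (y, 0) and
    (0, y).  The points of T on the remaining elements make y an
    eigenvector. *)
Lemma transversal_central T : transversals (range phi) R T ->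
  exists z, [/\ lin_combs center x z, z <> 0 & T = plane z].
Proof.
move=> [/has_dim2P[e [f TE]] TY Tpt].
have TZ h v : T v -> T (h *: v).
  by rewrite TE => -[a [d ->]]; exists (h * a), (h * d); rewrite scalerDr !scalerA.
have TD v w : T v -> T w -> T (v + w).
  rewrite TE => -[a [d ->]] [a' [d' ->]]; exists (a + a'), (d + d').
  by rewrite !scalerDl addrACA.
have point S : std_regulus xB S -> exists2 p, p != 0 & S p /\ T (phi p).
  move=> SR; have [|P [[/has_dim1P[v v0 PE] PT PS] _]] := Tpt (phi @` S).
    by exists S.
  have Pv : P v by rewrite PE; exists 1; rewrite ?scale1r.
  have [p Sp pE] := PS _ Pv; exists p; last by rewrite pE; split=> //; apply: PT.
  by apply/eqP => p0; apply: v0; rewrite -pE p0 linear0.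
have [|[w w'] w0 [[/= _ w'0] Tw]] := point (setT `*` [set 0]); first by left.
rewrite {}w'0 in w0 Tw.
have {}w0 : w <> 0 by move=> wz; move: w0; rewrite wz eqxx.
have [|[y' y] y0 [[u _ [uy' uy]] Ty]] := point (range (fun u => (lambda xB 1 u, u))).
  by right; exists 1.
rewrite -{}uy' -{}uy lambda1 in y0 Ty => {y y'}; rename u into y.
have {}y0 : y <> 0 by move=> yz; move: y0; rewrite yz eqxx.
have [|[v' v] v0 [[/= v'0 _] Tv]] := point ([set 0] `*` setT).
  right; exists 0 => //; apply/seteqP; split=> [_ [u _ <-]|[u' u] [/= -> _]].
    by rewrite /= lambda0.
  by exists u; rewrite // lambda0.
have {}v0 : v <> 0 by move=> vz; move: v0; rewrite v'0 vz eqxx.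
rewrite {}v'0 in Tv.
have spanned (u1 u2 : V) : T u1 -> T u2 ->
    (forall a d, a *: u1 + d *: u2 = 0 -> a = 0 /\ d = 0) ->
    forall u, T u -> exists a d, u = a *: u1 + d *: u2.
  by rewrite TE; apply: plane_spanned.
have T_plane u : u <> 0 -> T (phi (u, 0)) -> T (phi (0, u)) -> T = plane u.
  move=> u0 Tu1 Tu2; apply/seteqP; split=> [t Tt | _ [a [d ->]]].
    apply: spanned Tt => // a d; rewrite linear_pair -(linear0 phi) => /phi_inj.
    by move=> [] /div_scaler_eq0 -> // /div_scaler_eq0 ->.
  by apply: TD; apply: TZ.
(* The dependence: its second component is v = q y, so (0, y) is in T. *)
have [p [q]] : exists p q, phi (0, v) = p *: phi (w, 0) + q *: phi (y, y).
  apply: (spanned) => // a d; rewrite !scale_phi add_phi -(linear0 phi) => /phi_inj.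
  rewrite scaler0 add0r.
  move=> [+ /div_scaler_eq0 d0]; rewrite d0 // scale0r addr0.
  by move=> /div_scaler_eq0 ->.
rewrite !scale_phi add_phi scaler0 add0r => /phi_inj.
move=> [_ vE]; have q0 : q != 0 by apply/eqP => q0; apply: v0; rewrite vE q0 scale0r.
have Ty2 : T (phi (0, y)).
  have := TZ q^-1 _ Tv; by rewrite scale_phi vE scaler0 div_scalerK.
have Ty1 : T (phi (y, 0)).
  have := TD _ _ Ty (TZ (- 1) _ Ty2); rewrite scale_phi add_phi.
  by rewrite scaler0 scaleN1r addr0 subrr.
have [h [z [h0 zZ yE]]] : exists h z, [/\ h != 0, lin_combs center x z & y = h *: z].
  apply: eigenvector_center => // k.
  have [|p' p'0 [[u _ up] Tp]] := point (range (fun u => (lambda xB k u, u))).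
    by right; exists k.
  move: Tp; rewrite (T_plane y) // => -[a [d]]; rewrite linear_pair => /phi_inj pE.
  move: p'0 up; rewrite pE => p0 [ka ud].
  have d0 : d != 0.
    apply/eqP => d0; move: p0 ka; rewrite ud d0 !scale0r linear0 => + az.
    by rewrite -az eqxx.
  exists (d^-1 * a); rewrite -scalerA -ka ud linearZ /=.
  by rewrite div_scalerK.
have z0 : z <> 0 by move=> z0; apply: y0; rewrite yE z0 scaler0.
have zE : z = h^-1 *: y by rewrite yE div_scalerK.
exists z; split=> //; apply: T_plane => //.
  have := TZ h^-1 _ Ty1; by rewrite scale_phi scaler0 -zE.
have := TZ h^-1 _ Ty2; by rewrite scale_phi scaler0 -zE.
Qed.

(** Modulo X * 0 the plane belonging to z is its point on 0 * X. *)
Lemma sum_transversals :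
  [set sum_set im T | T in transversals (range phi) R] =
  [set sum_set im (range (fun k : K => k *: phi (0, z)))
    | z in lin_combs center x `\ 0].
Proof.
have sum_plane z : sum_set im (plane z) =
    sum_set im (range (fun k : K => k *: phi (0, z))).
  apply/seteqP; split=> _ [_ [[u _] [/= _ ->] <-] [w + <-]].
    move=> [a [d ->]]; exists (phi (u + a *: z, 0)); first by exists (u + a *: z, 0).
    exists (d *: phi (0, z)); first by exists d.
    rewrite addrA; congr (_ + _); rewrite scale_phi add_phi.
    by rewrite scaler0 addr0.
  move=> [k _ <-]; exists (phi (u, 0)); first by exists (u, 0).
  by exists (k *: phi (0, z)) => //; exists 0, k; rewrite scale0r add0r.
apply/seteqP; split=> S.
  move=> [T /transversal_central[z [zZ z0 ->]] <-].
  by exists z; rewrite ?sum_plane.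
move=> [z [zZ z0] <-]; rewrite -sum_plane; exists (plane z) => //.
exact: central_plane_transversal.
Qed.

End Transversals.
End DivisionRing.

(** * Linear maps, submodules and their bases *)

Section LinearConstructions.
Variables (K : nzRingType).

Lemma preimage_image_inj (A B : Type) (f : A -> B) (S : set A) :
  injective f -> f @^-1` (f @` S) = S.
Proof.
move=> f_inj; apply/seteqP; split=> [p [q Sq /f_inj <-] // | p Sp].
by exists p.
Qed.

Lemma image_set_inj (A B : Type) (f : A -> B) (S T : set A) :
  injective f -> f @` S = f @` T -> S = T.
Proof.
by move=> f_inj ST; rewrite -(preimage_image_inj S f_inj) ST preimage_image_inj.
Qed.

Lemma linear_factor (X Y V : lmodType K) (phi : {linear X -> V})
    (psi : {linear Y -> V}) : injective phi -> range psi `<=` range phi ->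
  exists theta : {linear Y -> X}, forall y, phi (theta y) = psi y.
Proof.
move=> phi_inj sub.
have /choice[t tE] (y : Y) : exists z, phi z = psi y.
  by have [|z _ zE] := sub (psi y); [exists y | exists z].
have t_lin : linear t by move=> k u v; apply: phi_inj; rewrite linearP !tE linearP.
pose m := GRing.isLinear.Build K Y X *:%R t t_lin.
pose T : {linear Y -> X} := HB.pack t m.
by exists T.
Qed.

Lemma mem_submod_closed (V : lmodType K) (A : set V) : GRing.submod_closed (mem A) <->
  A 0 /\ forall k u v, A u -> A v -> A (k *: u + v).
Proof.
split=> [[A0 Alin]|[A0 Alin]].
  split=> [|k u v Au Av]; first exact: set_mem A0.
  by apply: set_mem; apply: Alin; apply: mem_set.
split=> [|k u v Au Av]; first exact: mem_set.
by apply: mem_set; apply: Alin; apply: set_mem.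
Qed.

Lemma linear_proj_isomorphic (V V' : lmodType K) (phi : {linear V' -> V}) :
  injective phi -> proj_isomorphic (range phi) [set: V'].
Proof.
move=> phi_inj.
have im_pre (A : set V) : A `<=` range phi -> phi @` (phi @^-1` A) = A.
  move=> AY; apply/seteqP; split=> [_ [p Ap <-] // | v Av].
  by have [p _ pE] := AY v Av; exists p => //; rewrite /preimage /= pE.
exists (fun A => phi @^-1` A); split; first split.
- move=> A [AY /mem_submod_closed[A0 Alin]]; split=> //.
  apply/mem_submod_closed; split=> [|k u v Au Av]; rewrite /preimage /= ?linear0 //.
  by rewrite linearP; apply: Alin.
- move=> A B /set_mem[AY _] /set_mem[BY _] AB.
  by rewrite -(im_pre A AY) AB im_pre.
- move=> B [_ /mem_submod_closed[B0 Blin]]; exists (phi @` B); last first.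
    exact: preimage_image_inj.
  split; first by move=> _ [p _ <-]; exists p.
  apply/mem_submod_closed; split; first by exists 0; rewrite ?linear0.
  move=> k _ _ [p Bp <-] [q Bq <-]; exists (k *: p + q); first exact: Blin.
  by rewrite linearP.
move=> A B [AY _] [BY _]; split=> [AB p|AB]; first exact: AB.
by rewrite -(im_pre A AY) -(im_pre B BY); apply: image_subset.
Qed.

Lemma submod_basis (V : lmodType K) (S : submodClosed V) (J : eqType) (c : J -> V) :
  is_basis [set` S] c ->
  exists2 c' : J -> submod S, (forall j, val (c' j) = c j) & is_basis setT c'.
Proof.
move=> [c_free c_span].
have cS j : c j \in S.
  suff : [set` S] (c j) by [].
  by rewrite -c_span; exists [:: (1, j)]; rewrite big_seq1 scale1r.
have [c' c'E] : exists c' : J -> submod S, forall j, val (c' j) = c j.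
  by exists (fun j => Sub (c j) (cS j)) => j; rewrite SubK.
exists c' => //; split.
  move=> s k su s0; apply: c_free => //; rewrite -[RHS](linear0 (val : submod S -> V)).
  by rewrite -s0 linear_sum; apply: eq_bigr => j _; rewrite linearZ /= c'E.
apply/seteqP; split=> // v _; have : [set` S] (val v) := valP v.
rewrite -c_span => -[s [_ vE]]; exists s; split=> //; apply: val_inj.
by rewrite vE linear_sum; apply: eq_bigr => j _; rewrite linearZ /= c'E.
Qed.

Lemma lin_combs_image (V V' : lmodType K) (f : {linear V' -> V}) (C : set K)
    (J : eqType) (c : J -> V') :
  lin_combs C (f \o c) = f @` lin_combs C c.
Proof.
apply/seteqP; split=> [_ [s [sC ->]] | _ [_ [s [sC ->]] <-]].
  exists (\sum_(p <- s) p.1 *: c p.2); first by exists s.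
  by rewrite linear_sum; apply: eq_bigr => p _; rewrite linearZ.
by exists s; split=> //; rewrite linear_sum; apply: eq_bigr => p _; rewrite linearZ.
Qed.

End LinearConstructions.

(** * Reguli in a subspace with coordinates in X * X *)

Section FramedRegulus.
Variables (K : unitRingType) (K_div : GRing.field_axiom K).
Variables (V X : lmodType K) (phi : {linear (X * X)%type -> V}).
Hypothesis phi_inj : injective phi.
Hypothesis X_neq0 : exists u : X, u != 0.

Definition framed (J : eqType) (x : J -> X) (xB : is_basis setT x) : set (set V) :=
  [set phi @` S | S in std_regulus xB].

Let im : set V := phi @` (setT `*` [set 0]).

Lemma framed_regulus (J : eqType) (x : J -> X) (xB : is_basis setT x) :
  is_regulus (range phi) (framed xB).
Proof.
exists X, J, x, xB, phi; split=> //; split.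
- by move=> p _; exists p.
- by move=> p q _ _; apply: phi_inj.
- by move=> v [p _ <-]; exists p.
Qed.

(** Transports [regulus_normal_form] along phi: the linear bijection that defines
    R factors through phi. *)
Lemma regulus_framed (R : set (set V)) : is_regulus (range phi) R ->
  R im -> R (phi @` ([set 0] `*` setT)) -> R (phi @` range (fun u : X => (u, u))) ->
  exists (J : eqType) (x : J -> X) (xB : is_basis setT x), R = framed xB.
Proof.
move=> [Y [J [y [yB [psi [_ [psi_sub psi_inj psi_surj] ->]]]]]].
have sub : range psi `<=` range phi by move=> _ [p _ <-]; apply: psi_sub.
have [theta thetaE] := linear_factor phi_inj sub.
have theta_bij : bijective theta.
  have [] : (forall q, exists p, theta p = q) /\ injective theta.
    split=> [q | p q pq].
      have [|p _ pE] := psi_surj (phi q); first by exists q.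
      by exists p; apply: phi_inj; rewrite thetaE.
    by apply: psi_inj; rewrite ?inE // -!thetaE pq.
  move=> /choice[t tE] theta_inj; exists t => // p.
  by apply: theta_inj; rewrite tE.
pose R' := [set theta @` S | S in std_regulus yB].
have RE : [set psi @` S | S in std_regulus yB] = [set phi @` S | S in R'].
  have psiE S : psi @` S = phi @` (theta @` S).
    rewrite image_comp; congr (_ @` _); apply/funext => p /=; exact/esym/thetaE.
  rewrite image_comp; congr (_ @` _); apply/funext => S /=; exact: psiE.
have inR' S : [set phi @` S | S in R'] (phi @` S) -> R' S.
  by move=> [T TR /(image_set_inj phi_inj) <-].
rewrite RE => /inR' R1 /inR' R2 /inR' R3.
have [x [xB R'E]] := regulus_normal_form K_div X_neq0 theta_bij R1 R2 R3.
by exists J, x, xB; rewrite /R' R'E.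
Qed.

(** phi (0, z) lies in the sum of im and its own point; since it also lies in
    the sum of im and K phi (0, z') for a Z-combination z' of x, and im is the
    first factor, z is a multiple of z'. *)
Lemma framed_eq (J J' : eqType) (x : J -> X) (x' : J' -> X)
    (xB : is_basis setT x) (xB' : is_basis setT x') :
  [set sum_set im T | T in transversals (range phi) (framed xB')] =
  [set sum_set im T | T in transversals (range phi) (framed xB)] ->
  framed xB = framed xB'.
Proof.
rewrite /framed !(sum_transversals K_div _ phi_inj) => ZE.
congr (_ @` _); apply: (std_regulus_eq K_div) => // z zZ z0.
have : [set sum_set im (range (fun k : K => k *: phi (0, z)))
    | z in lin_combs center x' `\ 0] (sum_set im (range (fun k : K => k *: phi (0, z)))).
  by exists z.
rewrite ZE => -[z' [z'Z _] imE].
have : sum_set im (range (fun k : K => k *: phi (0, z))) (phi (0, z)).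
  exists 0; first by exists 0; rewrite ?linear0.
  by exists (phi (0, z)); rewrite ?add0r //; exists 1; rewrite ?scale1r.
rewrite -imE => -[_ [[u _] [_ /= ->] <-] [_ [k _ <-]]].
rewrite scale_phi add_phi => /phi_inj[_ kz].
by exists k, z'; rewrite -kz add0r.
Qed.

Lemma framed_affine (J : eqType) (x : J -> X) (xB : is_basis setT x) :
  framed xB `\ im =
  range (fun k : K => phi @` range (fun u => (lambda xB k u, u))).
Proof.
apply/seteqP; split=> [_ [[S [-> | [k _ <-]] <-] Sim] | _ [k _ <-]].
- by case: Sim.
- by exists k.
split; first by exists (range (fun u => (lambda xB k u, u))) => //; right; exists k.
move=> /(image_set_inj phi_inj) E; have [u u0] := X_neq0.
have : range (fun u => (lambda xB k u, u)) (lambda xB k u, u) by exists u.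
by rewrite E => -[_ /= /eqP]; rewrite (negbTE u0).
Qed.

Lemma framed_im (J : eqType) (x : J -> X) (xB : is_basis setT x) : framed xB im.
Proof. by exists (setT `*` [set 0]) => //; left. Qed.

Lemma framed_lambda (J : eqType) (x : J -> X) (xB : is_basis setT x) k :
  framed xB (phi @` range (fun u => (lambda xB k u, u))).
Proof. by exists (range (fun u => (lambda xB k u, u))) => //; right; exists k. Qed.

Lemma framed_complement (J : eqType) (x : J -> X) (xB : is_basis setT x) :
  framed xB (phi @` ([set 0] `*` setT)).
Proof.
suff <- : range (fun u => (lambda xB 0 u, u)) = [set 0] `*` setT.
  exact: framed_lambda.
apply/seteqP; split=> [_ [u _ <-] | [u' u] [/= -> _]]; first by rewrite /= lambda0.
by exists u; rewrite // lambda0.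
Qed.

Lemma framed_diagonal (J : eqType) (x : J -> X) (xB : is_basis setT x) :
  framed xB (phi @` range (fun u => (u, u))).
Proof.
suff <- : (fun u => (lambda xB 1 u, u)) = (fun u => (u, u)) by exact: framed_lambda.
by apply/funext => u; rewrite lambda1.
Qed.

End FramedRegulus.

(** * The line through the graph of alpha *)

Section Line.
Variables (K : unitRingType) (K_div : GRing.field_axiom K).
Variables (V : lmodType K) (W U : submodClosed V).
Hypothesis V_sum : is_direct_sum [set` W] [set` U] setT.
Variable alpha : {linear submod U -> submod W}.
Variable U' : submodClosed V.
Hypothesis U'_compl : is_direct_sum (kernel_hom alpha) [set` U'] [set` U].

Lemma direct_sum_eq (w u : V) : w \in W -> u \in U -> w + u = 0 -> w = 0 /\ u = 0.
Proof.
move=> wW uU /eqP; rewrite addr_eq0 => /eqP wE.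
have : ([set` W] `&` [set` U]) u.
  by split=> //=; rewrite -[u]opprK -wE -scaleN1r rpredZ.
by rewrite V_sum.2 => /= u0; rewrite wE u0 oppr0.
Qed.

Lemma complement_inclusion :
  exists inc : {linear submod U' -> submod U}, forall u, val (inc u) = val u.
Proof.
have sub (u : submod U') : val u \in U.
  suff : [set` U] (val u) by [].
  rewrite -U'_compl.1; exists 0; first by exists 0; rewrite //= linear0.
  by exists (val u); rewrite ?add0r //; exact: valP.
have [f fE] : exists f : submod U' -> submod U, forall u, val (f u) = val u.
  by exists (fun u => Sub (val u) (sub u)) => u; rewrite SubK.
have f_lin : linear f by move=> k u v; apply: val_inj; rewrite !linearP /= !fE.
pose m := GRing.isLinear.Build K _ _ *:%R f f_lin.
pose F : {linear submod U' -> submod U} := HB.pack f m.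
by exists F.
Qed.

Variable inc : {linear submod U' -> submod U}.
Hypothesis incE : forall u, val (inc u) = val u.

Definition frame (p : submod U' * submod U') : V :=
  val (alpha (inc p.1)) + val p.2.

Lemma frameE u v : frame (u, v) = val (alpha (inc u)) + val v.
Proof. by []. Qed.

Lemma frame_is_linear : linear frame.
Proof.
by move=> k p q; rewrite /frame !linearP /= scalerDr addrACA.
Qed.

HB.instance Definition _ :=
  GRing.isLinear.Build K (submod U' * submod U')%type V *:%R frame frame_is_linear.

Lemma alpha_inc_inj u : alpha (inc u) = 0 -> u = 0.
Proof.
move=> au0; apply: val_inj; rewrite linear0.
have : (kernel_hom alpha `&` [set` U']) (val u).
  by split; [exists (inc u) | exact: valP].
by rewrite U'_compl.2.
Qed.

Lemma frame_inj : injective frame.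
Proof.
apply: raddf_inj => -[u v] /direct_sum_eq[||/= au0 v0]; first exact: valP.
  by rewrite -incE; exact: valP.
congr (_, _); last by apply: val_inj; rewrite linear0.
by apply: alpha_inc_inj; apply: val_inj; rewrite linear0.
Qed.

(** U = ker(alpha) + U', so every value of alpha is attained on U'. *)
Lemma image_alpha_inc : image_hom alpha = range (fun u => val (alpha (inc u))).
Proof.
apply/seteqP; split=> _ [u _ <-]; last by exists (inc u).
have : [set` U] (val u) := valP u.
rewrite -U'_compl.1 => -[_ [k k0 <-] [u' u'U uE]].
pose u1 : submod U' := Sub u' u'U.
suff uE1 : alpha (inc u1) = alpha u by exists u1; rewrite ?uE1.
apply/eqP; rewrite -subr_eq0 -linearB.
suff -> : inc u1 - u = - k by rewrite linearN k0 oppr0.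
apply: val_inj; rewrite linearB linearN /= incE SubK -uE.
by rewrite opprD addrCA subrr addr0.
Qed.

Lemma frame_im : frame @` (setT `*` [set 0]) = image_hom alpha.
Proof.
rewrite image_alpha_inc; apply/seteqP; split=> [_ [[u _] [/= _ ->] <-] | _ [u _ <-]].
  by exists u => //; rewrite frameE linear0 addr0.
by exists (u, 0); rewrite // frameE linear0 addr0.
Qed.

Lemma frame_complement : frame @` ([set 0] `*` setT) = [set` U'].
Proof.
apply/seteqP; split=> [_ [[_ u] [/= -> _] <-] | v vU].
  by rewrite frameE !linear0 add0r; exact: valP.
by exists (0, Sub v vU) => //; rewrite frameE !linear0 add0r SubK.
Qed.

Lemma range_frame : range frame = sum_set (image_hom alpha) [set` U'].
Proof.
rewrite image_alpha_inc; apply/seteqP; split=> [_ [[u v] _ <-] | _ [_ [u _ <-] [v vU <-]]].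
  by exists (val (alpha (inc u))); [exists u | exists (val v) => //; exact: valP].
by exists (u, Sub v vU).
Qed.

Lemma frame_graph : frame @` range (fun u => (u, u)) = graph_on alpha [set` U'].
Proof.
apply/seteqP; split=> [_ [_ [u _ <-] <-] | _ [u uU' <-]].
  exists (inc u); first by rewrite /= incE; exact: valP.
  by rewrite frameE incE.
pose u' : submod U' := Sub (val u) uU'.
have u'E : inc u' = u by apply: val_inj; rewrite incE SubK.
by exists (u', u'); [exists u' | rewrite frameE u'E SubK].
Qed.

Variables (I : eqType) (b : I -> submod U) (b_basis : is_basis setT b).
Variables (J : eqType) (c : J -> V) (c' : J -> submod U').
Hypothesis c'E : forall j, val (c' j) = c j.
Hypothesis c_central : central_basis b [set` U'] c.
Hypothesis c'B : is_basis setT c'.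

(** A central basis vector c_j is a Z-combination of the b_i, so the lambda_k of
    b sends it to k c_j. *)
Lemma lambda_central_subspace k u :
  inc (lambda c'B k u) = lambda b_basis k (inc u).
Proof.
apply: (linear_extension_unique c'B (f := inc \o lambda c'B k)
  (g := lambda b_basis k \o inc)) => j /=.
rewrite lambdaE linearZ /=; apply/esym.
apply: (lin_combs_centerP b_basis _).1.
have := c_central.2 j.
rewrite (lin_combs_image (val : {linear submod U -> V}) center b).
by move=> [v vZ vE]; suff -> : inc (c' j) = v by []; apply: val_inj; rewrite incE c'E.
Qed.

(** Y is any additively closed set between im(alpha) + U' and W + U': a vector of the graph in
    W + U' has its U-component in U'.  Taking either end for Y gives the
    equality of the two traces. *)
Lemma traces_line (Y : set V) :
  [set` U'] `<=` Y -> image_hom alpha `<=` Y ->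
  Y `<=` sum_set [set` W] [set` U'] -> (forall u v, Y u -> Y v -> Y (u + v)) ->
  traces (line b_basis alpha \0) Y =
  range (fun k : K => frame @` range (fun u => (lambda c'B k u, u))).
Proof.
move=> U'Y imY YW YD.
have main k : graph ((alpha \o lambda b_basis k) \+ \0) `&` Y =
    frame @` range (fun u => (lambda c'B k u, u)).
  apply/seteqP; split=> [v [[u _ <-]] /= | _ [_ [u _ <-] <-]].
    move=> /YW [w wW [u' u'U E]].
    pose u1 : submod U' := Sub u' u'U.
    have uE : inc u1 = u.
      apply: val_inj; apply/eqP; rewrite -subr_eq0 -linearB; apply/eqP.
      suff : (w - val (alpha (lambda b_basis k u) + 0)) + val (inc u1 - u) = 0.
        move=> /direct_sum_eq[||//]; last exact: valP.
        by rewrite -scaleN1r rpredD ?rpredZ //; exact: valP.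
      by rewrite linearB /= incE SubK addrACA E -opprD subrr.
    exists (lambda c'B k u1, u1); first by exists u1.
    by rewrite frameE lambda_central_subspace uE addr0 -uE incE.
  split.
    exists (inc u); first exact: valP.
    by rewrite /= frameE lambda_central_subspace incE addr0.
  apply: YD; last by apply: U'Y; exact: valP.
  by apply: imY; exists (inc (lambda c'B k u)).
apply/seteqP; split=> [_ [_ [k _ <-] <-] | _ [k _ <-]].
  by exists k; rewrite // main.
exists (graph ((alpha \o lambda b_basis k) \+ \0)); first by exists k.
exact: main.
Qed.

Lemma central_points_image :
  [set sum_set (image_hom alpha) P | P in central_points c] =
  [set sum_set (image_hom alpha) (range (fun k : K => k *: frame (0, z)))
    | z in lin_combs center c' `\ 0].
Proof.
have -> : c = val \o c' by apply/funext => j /=; rewrite c'E.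
rewrite /central_points (lin_combs_image (val : {linear submod U' -> V}) center c').
have frame0 z : frame (0, z) = val z by rewrite frameE !linear0 add0r.
apply/seteqP; split=> [_ [_ [_ [[z zZ <-] z0] <-] <-] | _ [z [zZ z0] <-]].
  exists z; last by rewrite frame0.
  by split=> // z_eq0; apply: z0; rewrite z_eq0; exact: linear0.
exists (range (fun k : K => k *: val z)); last by rewrite frame0.
exists (val z) => //; split; first by exists z.
by move=> vz0; apply: z0; apply: val_inj; rewrite linear0.
Qed.

End Line.

Theorem theorem4p10 (K : unitRingType) (K_div : GRing.field_axiom K)
    (V : lmodType K) (W U : submodClosed V)
    (W_neq0 : [set` W] <> [set 0]) (W_neqT : [set` W] <> setT)
    (V_sum : is_direct_sum [set` W] [set` U] setT)
    (I : eqType) (b : I -> submod U) (b_basis : is_basis setT b)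
    (alpha : {linear submod U -> submod W}) (alpha_neq0 : ~ (alpha =1 \0))
    (U' : submodClosed V) (U'_central : central b [set` U'])
    (U'_compl : is_direct_sum (kernel_hom alpha) [set` U'] [set` U]) :
  let l := line b_basis alpha \0 in
  let im := image_hom alpha in
  let Y := sum_set im [set` U'] in
  let L := traces l Y in
  [/\ traces l (sum_set [set` W] [set` U']) = L,
      proj_isomorphic Y [set: submod U' * submod U'],
      is_affine_regulus Y im L &
      forall R, associated_regulus Y im L R ->
      forall (J : eqType) (c : J -> V), central_basis b [set` U'] c ->
        unique (fun R' : set (set V) =>
          [/\ is_regulus Y R',
              [/\ R' im, R' [set` U'] & R' (graph_on alpha [set` U'])] &
              [set sum_set im T | T in transversals Y R'] =
              [set sum_set im P | P in central_points c]]) R].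
Proof.
move=> l im Y L.
have [inc incE] := complement_inclusion U'_compl.
pose phi : {linear (submod U' * submod U')%type -> V} := frame alpha inc.
have phi_inj : injective phi := frame_inj V_sum U'_compl incE.
have YE : Y = range phi by rewrite (range_frame U'_compl).
have imE : im = phi @` (setT `*` [set 0]) by rewrite (frame_im U'_compl).
have U'_neq0 : exists u : submod U', u != 0.
  apply: contrapT => no; apply: alpha_neq0 => u; apply: val_inj.
  have : image_hom alpha (val (alpha u)) by exists u.
  rewrite (image_alpha_inc U'_compl incE) => -[u' _ <-].
  have -> : u' = 0 by apply/eqP; apply: contra_notT no => u'0; exists u'.
  by rewrite !linear0.
have traceE (J : eqType) (c : J -> V) (c' : J -> submod U')
    (c'E : forall j, val (c' j) = c j) (cZ : central_basis b [set` U'] c)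
    (c'B : is_basis setT c') :
  traces l (sum_set [set` W] [set` U']) =
    range (fun k : K => phi @` range (fun u => (lambda c'B k u, u))) /\
  L = range (fun k : K => phi @` range (fun u => (lambda c'B k u, u))).
  have imW : image_hom alpha `<=` [set` W] by move=> _ [u _ <-]; exact: valP.
  have U'0 : [set` U'] 0 by rewrite /= rpred0.
  have sumD (A : set V) : (forall u v, A u -> A v -> A (u + v)) ->
      forall u v, sum_set A [set` U'] u -> sum_set A [set` U'] v ->
        sum_set A [set` U'] (u + v).
    move=> AD _ _ [u Au [u' u'U <-]] [v Av [v' v'U <-]]; rewrite addrACA.
    by exists (u + v); [exact: AD | exists (u' + v'); rewrite //= rpredD].
  have im0 : image_hom alpha 0 by exists 0; rewrite //= !linear0.
  have imD u v : image_hom alpha u -> image_hom alpha v -> image_hom alpha (u + v).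
    by move=> [u1 _ <-] [v1 _ <-]; exists (u1 + v1); rewrite // !linearD.
  split; apply: (traces_line V_sum incE b_basis c'E cZ c'B).
  - by move=> u uU; exists 0; [rewrite /= rpred0 | exists u; rewrite ?add0r].
  - by move=> w wim; exists w; [exact: imW | exists 0; rewrite ?addr0].
  - by [].
  - by apply: sumD => u v uW vW; rewrite /= rpredD.
  - by move=> u uU; exists 0; [exact: im0 | exists u; rewrite ?add0r].
  - by move=> w wim; exists w; [exact: wim | exists 0; rewrite ?addr0].
  - by move=> _ [w wim [u uU <-]]; exists w; [exact: imW | exists u].
  - exact: sumD.
have [J [c cZ]] := U'_central.
have [c' c'E c'B] := submod_basis cZ.1.
have [WL LE] := traceE J c c' c'E cZ c'B.
rewrite -(framed_affine phi_inj U'_neq0) -imE in LE.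
split.
- by rewrite WL; case: (traceE J c c' c'E cZ c'B) => _ ->.
- by rewrite YE; exact: linear_proj_isomorphic.
- exists (framed phi c'B); split=> //.
  + by rewrite YE; exact: framed_regulus.
  + by rewrite imE; exact: framed_im.
move=> R [_ Rim LR] J1 c1 c1Z.
have [c1' c1'E c1'B] := submod_basis c1Z.1.
have [_ L1E] := traceE J1 c1 c1' c1'E c1Z c1'B.
rewrite -(framed_affine phi_inj U'_neq0) -imE in L1E.
have RE : R = framed phi c1'B.
  have F_im : framed phi c1'B im by rewrite imE; exact: framed_im.
  by rewrite -(setD1K Rim) -(setD1K F_im) -L1E LR.
have central_pts : [set sum_set im T | T in transversals Y (framed phi c1'B)] =
    [set sum_set im P | P in central_points c1].
  rewrite (central_points_image alpha inc c1'E) YE imE (sum_transversals K_div _ phi_inj).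
  by rewrite (frame_im U'_compl).
rewrite RE; split.
  split=> //; first by rewrite YE; exact: framed_regulus.
  rewrite -(frame_graph alpha incE) -(frame_complement alpha inc).
  split; first by rewrite imE; exact: framed_im.
    exact: framed_complement.
  exact: framed_diagonal.
move=> R' [R'reg [R'im R'U' R'graph]]; rewrite -central_pts => R'pts.
rewrite YE in R'reg; rewrite imE in R'im.
rewrite -(frame_complement alpha inc) in R'U'.
rewrite -(frame_graph alpha incE) in R'graph.
have [J2 [c2 [c2B R'E]]] := regulus_framed K_div phi_inj U'_neq0 R'reg R'im R'U' R'graph.
by rewrite R'E in R'pts *; apply: (framed_eq K_div phi_inj U'_neq0); rewrite -YE -imE.
Qed.
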